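(* For any integer $k\geq 3$ and any integer $r\geq 0$, there are infinitely many values of $v$ for which there exists a $(v,k;r)$ Heffter space.
   Context: A $(v_r,b_k)$ configuration is a point-block incidence structure $(V,\mathcal{B})$ with $|V|=v$ points and $b$ blocks, each block a $k$-subset of $V$, such that any two distinct points lie in at most one common block (partial linear space) and every point lies in exactly $r$ blocks. It is resolvable if $\mathcal{B}$ can be partitioned into $r$ classes (parallel classes), each of which is a partition of $V$. A subset $V$ of an abelian group $G$ is a half-set of $G$ if $V$ and $-V$ partition $G\setminus\{0\}$. A $(v,k;r)$ Heffter space over an abelian group $G$ is a resolvable $(v_r,b_k)$ configuration whose point set $V\subseteq G$ is a half-set of $G$ and each of whose blocks is zero-sum in $G$. (A $(v,k;r)$ Heffter space is a $(v,k;r)$ Heffter space over some abelian group.) *)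

(* Defs.v *)
From HB Require Import structures.
From mathcomp Require Import all_boot all_order all_algebra.

Set Implicit Arguments.
Unset Strict Implicit.
Unset Printing Implicit Defensive.

Import GRing.Theory.
Local Open Scope ring_scope.

Definition is_configuration (T : finType) (v r b k : nat)
    (V : {set T}) (B : {set {set T}}) : Prop :=
  [/\ #|V| = v,
      #|B| = b,
      (forall A, A \in B -> A \subset V /\ #|A| = k),
      (forall x y, x \in V -> y \in V -> x != y ->
         (#|[set A in B | (x \in A) && (y \in A)]| <= 1)%N) &
      (forall x, x \in V -> #|[set A in B | x \in A]| = r)].

Definition is_resolvable (T : finType) (r : nat)
    (V : {set T}) (B : {set {set T}}) : Prop :=
  exists P : {set {set {set T}}},
    [/\ partition P B, #|P| = r & forall C, C \in P -> partition C V].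

(* Not stated as [partition [set V; - V] [set~ 0]]: that would also accept
   V = - V = [set~ 0], where the two parts collapse into one. *)
Definition is_half_set (G : finZmodType) (V : {set G}) : Prop :=
  [disjoint V & [set - x | x in V]] /\
  V :|: [set - x | x in V] = [set~ 0].

(* A group having a half-set with v points has order 2v + 1, so restricting
   to finite abelian groups loses no generality. *)
Definition is_heffter_space (G : finZmodType) (v k r : nat)
    (V : {set G}) (B : {set {set G}}) : Prop :=
  [/\ exists b : nat, is_configuration v r b k V B,
      is_resolvable r V B,
      is_half_set V &
      forall A, A \in B -> \sum_(x in A) x = 0].

Definition heffter_space_exists (v k r : nat) : Prop :=
  exists (G : finZmodType) (V : {set G}) (B : {set {set G}}),
    is_heffter_space v k r V B.

(* Main.v *)
Require Import Defs.
From mathcomp Require Import classical_sets cardinality.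
From mathcomp Require Import all_boot all_order all_algebra.
From mathcomp Require Import all_solvable all_field zify.

Set Implicit Arguments.
Unset Strict Implicit.
Unset Printing Implicit Defensive.

Import GRing.Theory.

(* Work in a field [F] of order [q], fix a generator [g] of the multiplicative
   group and an even [N], divisible by [2 * k], with [(q - 1) / N] odd.  The
   elements whose discrete logarithm modulo [N] is less than [N / 2] form a
   half-set [V], because [-1] has logarithm [N / 2] modulo [N].  If
   [x_0, ..., x_(k-1)] is a zero-sum tuple with [log x_i = i] modulo [N], then
   the multiples [s * {x_0, ..., x_(k-1)}] with [log s] modulo [N] a multiple of [k]
   less than [N / 2] partition [V].  For the [r] parallel classes take tuples
   [x^a] with [log x^a_i = i + N * a * i] modulo [N * L], where [L > 2 * r * k]:
   two blocks of distinct classes sharing two points would force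
   [(a - b) * (i - j) = 0] modulo [L].  Such tuples exist as soon as the classes
   of the logarithm modulo [N * L] have more than [q ^ (3 / 4)] elements, by the
   second moment bound for point-line incidences in the plane over [F]. *)

(** * Point-line incidences in the plane over a finite field *)

Section Incidence.

Variable F : finFieldType.
Local Open Scope ring_scope.

(** The point [(x, y)] is on the line [x + m * y + w = s] with parameters [l = (m, w)]. When all
    four coordinates are powers of [g], this writes [s] as a sum of three powers. *)
Definition incident (s : F) (p l : F * F) : bool := p.1 + l.1 * p.2 + l.2 == s.

Lemma card_incident (s : F) (p : F * F) : #|[set l | incident s p l]| = #|F|.
Proof.
rewrite -cardsT -(@card_imset _ _ (fun m => (m, s - (p.1 + m * p.2)))).
  apply: eq_card => -[m w]; rewrite inE /incident /=; apply/eqP/imsetP.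
    by move=> <-; exists m; rewrite // [_ + w]addrC addrK.
  by case=> m' _ [-> ->]; rewrite addrC subrK.
by move=> m m' [].
Qed.

(** Subtracting the two equations determines the slope [l.1] of a line through two distinct points,
    and then [l.2]. *)
Lemma card_incident2 (s : F) (p p' : F * F) :
  (#|[set l | incident s p l && incident s p' l]| <= 1 + #|F| * (p == p'))%N.
Proof.
have [->|neq] := eqVneq p p'.
  rewrite muln1 -(card_incident s p') leqW // subset_leq_card //.
  by apply/subsetP=> l; rewrite !inE andbb.
rewrite muln0 addn0; apply/card_le1_eqP.
have key : forall l, l \in [set l | incident s p l && incident s p' l] ->
    p.2 != p'.2 /\ l = ((p'.1 - p.1) / (p.2 - p'.2), s - (p.1 + l.1 * p.2)).
  move=> [m w]; rewrite inE /incident /= => /andP[/eqP e /eqP e'].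
  have E : p.1 + m * p.2 = p'.1 + m * p'.2 by apply: (@addIr _ w); rewrite e.
  have ne2 : p.2 != p'.2.
    apply: contraNneq neq => e2; rewrite e2 in E.
    by case: (p) (p') e2 E => x z [x' z'] /= -> /addIr ->.
  split=> //; congr pair; last by rewrite -e addrC addKr.
  apply: (@mulIf _ (p.2 - p'.2)); first by rewrite subr_eq0.
  rewrite divfK ?subr_eq0 // mulrBr.
  by apply/eqP; rewrite subr_eq addrAC eq_sym subr_eq -E addrC.
move=> l l' lA l'A.
have [_ e] := key _ lA; have [_ e'] := key _ l'A.
have e1 : l'.1 = l.1 by rewrite e e'.
by rewrite [LHS]e' [RHS]e e1.
Qed.

(* Second moment over all [q ^ 2] lines: a line misses [P] only at the cost of
   [#|P| ^ 2] in a sum whose total excess is at most [q ^ 3 * #|P|]. *)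
Lemma incident_exists (s : F) (P L : {set F * F}) :
  (#|F| ^ 3 < #|P| * #|L|)%N ->
  exists p l, [/\ p \in P, l \in L & incident s p l].
Proof.
move=> big; pose q := #|F|; pose n := #|P|.
pose I l := (\sum_(p in P) incident s p l)%N.
case: (boolP [exists p in P, exists l in L, incident s p l]) => [|no].
  by case/exists_inP=> p pP /exists_inP[l lL pl]; exists p, l.
have I0 l : l \in L -> I l = 0%N.
  move=> lL; apply: big1 => p pP; apply/eqP; rewrite eqb0.
  by apply: contraNN no => pl; apply/exists_inP; exists p => //;
     apply/exists_inP; exists l.
have sumI : (\sum_l I l = q * n)%N.
  rewrite exchange_big /= mulnC -sum_nat_const; apply: eq_bigr => p pP.
  rewrite /q -(card_incident s p) -sum1dep_card [RHS]big_mkcond.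
  by apply: eq_bigr => l _; case: ifP.
have sumI2 : (\sum_l I l ^ 2 <= n ^ 2 + q * n)%N.
  have -> : (\sum_l I l ^ 2 = \sum_(p in P) \sum_(p' in P)
             #|[set l | incident s p l && incident s p' l]|)%N.
    rewrite (eq_bigr (fun l => \sum_(p in P) \sum_(p' in P)
               (incident s p l && incident s p' l))%N); last first.
      move=> l _; rewrite -mulnn /I big_distrl; apply: eq_bigr => p _.
      by rewrite big_distrr; apply: eq_bigr => p' _; rewrite /= mulnb.
    rewrite exchange_big; apply: eq_bigr => p _.
    rewrite exchange_big; apply: eq_bigr => p' _.
    by rewrite -sum1dep_card [RHS]big_mkcond; apply: eq_bigr => l _; case: ifP.
  apply: (@leq_trans (\sum_(p in P) (n + q))%N); last first.
    by rewrite sum_nat_const -/n mulnDr mulnn [(q * n)%N]mulnC.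
  apply: leq_sum => p pP.
  apply: (@leq_trans (\sum_(p' in P) (1 + q * (p == p')))%N).
    by apply: leq_sum => p' _; exact: card_incident2.
  rewrite big_split /= sum1_card leq_add2l -big_distrr /= (bigD1 p) //= eqxx.
  by rewrite big1 ?addn0 ?muln1 // => p' /andP[_]; rewrite eq_sym => /negbTE ->.
(* This is [(q * I l - n) ^ 2 >= 0], the deviation from the mean [n / q]; on [L], where [I l = 0],
   the term [n ^ 2] can be kept on the left. *)
have AGM l :
    (2 * (q * n * I l) + (l \in L) * n ^ 2 <= q ^ 2 * I l ^ 2 + n ^ 2)%N.
  case: (boolP (l \in L)) => [/I0 ->|_]; first by lia.
  rewrite mul0n addn0 -expnMn.
  by rewrite mulnAC; case: (nat_Cauchy (q * I l) n).
have : (\sum_l (2 * (q * n * I l) + (l \in L) * n ^ 2)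
        <= \sum_l (q ^ 2 * I l ^ 2 + n ^ 2))%N by exact: leq_sum.
have -> : (\sum_l (2 * (q * n * I l) + (l \in L) * n ^ 2)
           = 2 * (q * n * (q * n)) + #|L| * n ^ 2)%N.
  rewrite big_split -big_distrr -big_distrr -big_distrl /= sumI.
  by rewrite -sum1_card -big_mkcond.
have -> : (\sum_l (q ^ 2 * I l ^ 2 + n ^ 2)
           = q ^ 2 * (\sum_l I l ^ 2) + q * q * n ^ 2)%N.
  by rewrite big_split -big_distrr sum_nat_const card_prod.
have : (q ^ 2 * (\sum_l I l ^ 2) <= q ^ 2 * (n ^ 2 + q * n))%N.
  by rewrite leq_mul2l sumI2 orbT.
move: (\sum_l _)%N => S H2 H; exfalso.
have {H2}H : (#|L| * n ^ 2 <= q ^ 3 * n)%N by lia.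
have n0 : (0 < n)%N by rewrite /n; case: (#|P|) big.
have : (#|L| * n <= q ^ 3)%N by rewrite -(leq_pmul2r n0) -mulnA mulnn.
by rewrite leqNgt mulnC big.
Qed.

End Incidence.

(** * Discrete logarithms and zero-sum tuples with prescribed logarithms *)

Section DiscreteLog.

Variable F : finFieldType.
Local Open Scope ring_scope.

Lemma field_generator :
  exists2 g : F, (#|F|.-1).-primitive_root g &
    exists2 log : F -> nat, (forall x : F, x != 0 -> g ^+ log x = x) &
      forall n, log (g ^+ n) = n %[mod #|F|.-1].
Proof.
have q1 : (1 < #|F|)%N := card_finNzRing_gt1 F.
have q0 : (0 < #|F|.-1)%N by lia.
have expf_pred (x : F) : x != 0 -> x ^+ #|F|.-1 = 1.
  move=> x0; apply: (mulfI x0).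
  by rewrite -exprS prednK ?mulr1 ?expf_card //; lia.
have : has (#|F|.-1).-primitive_root (enum [set~ (0 : F)]).
  apply: has_prim_root => //; last by rewrite -cardE cardsC1.
    apply/allP => x; rewrite mem_enum !inE => x0.
    by apply/unity_rootP/expf_pred.
  exact: enum_uniq.
case/hasP=> g _ prim; exists g => //.
(* The default [0] is reached only at [x = 0]. *)
pose log x : nat := odflt 0%N (omap val [pick i : 'I_#|F|.-1 | x == g ^+ i]).
have logK (x : F) : x != 0 -> g ^+ log x = x.
  move=> x0; rewrite /log; case: pickP => [i /eqP //|/=].
  by have [i -> /(_ i)/eqP] := prim_rootP prim (expf_pred x x0).
exists log => // n; apply/eqP; rewrite -(eq_prim_root_expr prim) logK //.
by rewrite expf_neq0 // (prim_root_eq0 prim); lia.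
Qed.

Variables (g : F) (M n : nat).
Hypothesis prim_g : (#|F|.-1).-primitive_root g.
Hypothesis cardF : #|F|.-1 = (M * n)%N.
Hypothesis large : (#|F| ^ 3 < n ^ 4)%N.

(** The coset of [g ^ c] modulo the group of nonzero [M]-th powers, which has order [n]. *)
Definition log_class (c : nat) : {set F} := [set g ^+ (c + M * t) | t : 'I_n].

Lemma card_log_class c : #|log_class c| = n.
Proof.
rewrite card_imset ?card_ord // => t u /eqP.
rewrite (eq_prim_root_expr prim_g) eqn_modDl cardF -!muln_modr eqn_pmul2l.
  by rewrite !modn_small // => /eqP/val_inj.
by have := prim_order_gt0 prim_g; rewrite cardF muln_gt0 => /andP[].
Qed.

(** Points range over classes [a] and [b], lines over classes [0] and [c]: a product from classes
    [0] and [b] is again in class [b], and [n ^ 4 > q ^ 3] forces an incidence. *)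
Lemma log_class_sum3 (s : F) (a b c : nat) :
  exists x y z, [/\ x = a %[mod M], y = b %[mod M], z = c %[mod M] &
    g ^+ x + g ^+ y + g ^+ z = s].
Proof.
have [|p [l []]] := @incident_exists F s
    (setX (log_class a) (log_class b)) (setX (log_class 0) (log_class c)).
  by rewrite !cardsX !card_log_class !mulnn -expnM.
rewrite !inE => /andP[/imsetP[t1 _ e1] /imsetP[t2 _ e2]].
move=> /andP[/imsetP[t3 _ e3] /imsetP[t4 _ e4]].
rewrite /incident e1 e2 e3 e4 -exprD => /eqP e.
exists (a + M * t1)%N, (b + M * (t2 + t3))%N, (c + M * t4)%N.
split; try by rewrite addnC mulnC modnMDl.
by rewrite -e; congr (_ + _ ^+ _ + _); lia.
Qed.

(** All terms but the first three are fixed arbitrarily in their classes; the first three absorb the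
    remaining sum. *)
Lemma log_zero_sum (k : nat) (a : nat -> nat) : (3 <= k)%N ->
  exists2 f : nat -> nat, (forall i, f i = a i %[mod M]) &
    \sum_(i < k) g ^+ f i = 0.
Proof.
case: k => [|[|[|k]]] // _.
have [x [y [z [ex ey ez e]]]] :=
  log_class_sum3 (- \sum_(i < k) g ^+ a i.+3) (a 0%N) (a 1%N) (a 2%N).
exists (fun i => match i with 0 => x | 1 => y | 2 => z | _ => a i end)%N.
  by move=> [|[|[|i]]].
by rewrite !big_ord_recl /= !addrA e addrC subrr.
Qed.

End DiscreteLog.

(** * From pairwise almost disjoint partitions to a Heffter space *)

Lemma heffter_space_of_partitions (G : finZmodType) (k r : nat) (V : {set G})
    (C : 'I_r -> {set {set G}}) :
  1 < k -> V != set0 -> is_half_set V -> (forall a, partition (C a) V) ->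
  (forall a A, A \in C a -> #|A| = k /\ (\sum_(x in A) x = 0)%R) ->
  (forall a b A A', a != b -> A \in C a -> A' \in C b -> #|A :&: A'| <= 1) ->
  heffter_space_exists #|V| k r.
Proof.
move=> k1 V0 halfV partC blockC meetC.
(* A block in two classes would meet itself in [k > 1] points. *)
have Cinj a b A : A \in C a -> A \in C b -> a = b.
  move=> Aa Ab; apply/eqP; apply: contraLR k1 => ab.
  by rewrite -(proj1 (blockC _ _ Aa)) -leqNgt -[A]setIid (meetC a b).
have pbC a x : x \in V -> (pblock (C a) x \in C a) * (x \in pblock (C a) x).
  by move=> xV; rewrite mem_pblock pblock_mem (cover_partition (partC a)).
have Cinj' : injective C.
  have [x xV] := set0Pn _ V0.
  move=> a b ab; apply: (@Cinj a b (pblock (C a) x)); first by rewrite pbC.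
  by rewrite -ab pbC.
pose B := \bigcup_a C a.
have BP A : reflect (exists a, A \in C a) (A \in B).
  by apply: (iffP bigcupP) => [[a _ ?]|[a ?]]; exists a.
exists G, V, B; split=> //.
- exists #|B|; split=> //.
  + move=> A /BP[a Aa]; split; last by case: (blockC _ _ Aa).
    by rewrite -(cover_partition (partC a)); exact: (bigcup_sup A).
  + move=> x y xV yV xy; apply/card_le1_eqP => A A'.
    rewrite !inE => /and3P[/BP[a Aa] xA yA] /and3P[/BP[b Ab] xA' yA'].
    have [ab|ab] := eqVneq a b.
      rewrite -ab in Ab; have /and3P[_ triv _] := partC a.
      by rewrite -(def_pblock triv Aa xA) -(def_pblock triv Ab xA').
    have := meetC _ _ _ _ ab Aa Ab; rewrite leqNgt => /negP[].
    rewrite (leq_trans _ (subset_leq_card (_ : [set x; y] \subset _))) //.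
      by rewrite cards2 xy.
    by apply/subsetP => z; rewrite !inE => /orP[] /eqP ->; apply/andP.
  + move=> x xV; rewrite -[RHS]card_ord.
    rewrite -(card_imset _ (_ : injective (fun a => pblock (C a) x))).
      apply: eq_card => A; rewrite !inE; apply/andP/imsetP.
        case=> /BP[a Aa] xA; exists a => //.
        by have /and3P[_ triv _] := partC a; rewrite (def_pblock triv Aa xA).
      by case=> a _ ->; split; [apply/BP; exists a|]; rewrite pbC.
    move=> a b e; apply: (@Cinj a b (pblock (C a) x)); first by rewrite pbC.
    by rewrite e pbC.
- exists [set C a | a : 'I_r]; split.
  + apply/and3P; split.
    * by rewrite cover_imset.
    * apply/trivIsetP => _ _ /imsetP[a _ ->] /imsetP[b _ ->] ab.
      rewrite -setI_eq0; apply/eqP/setP => A; rewrite !inE; apply/negP.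
      by case/andP=> Aa Ab; move: ab; rewrite (Cinj _ _ _ Aa Ab) eqxx.
    * apply/negP => /imsetP[a _ Ca0]; have [x /(pbC a)] := set0Pn _ V0.
      by rewrite -Ca0 inE => -[].
  + by rewrite card_imset ?card_ord.
  + by move=> _ /imsetP[a _ ->].
- by move=> A /BP[a /blockC[]].
Qed.

Lemma eq_mod_dvdn (d m a b : nat) : d %| m -> a = b %[mod m] -> a = b %[mod d].
Proof. by move=> dm ab; rewrite -(modn_dvdm a dm) ab modn_dvdm. Qed.

(** The hypothesis is [(a - b) * (i - j) = 0] without truncated subtraction. *)
Lemma cross_products_eq (a b i j : nat) :
  a * i + b * j = b * i + a * j -> a = b \/ i = j.
Proof. by case: (ltngtP a b) => ab; [nia|nia|left]. Qed.

(** * The parallel classes inside a suitable field *)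

Section HeffterSpaceOfField.

Variables (F : finFieldType) (k w L n r : nat).
Hypothesis k3 : 3 <= k.
Hypothesis cardF : #|F|.-1 = 2 * (k * w) * L * n.
Hypothesis odd_Ln : odd (L * n).
Hypothesis Lrk : 2 * (r * k) < L.
Hypothesis large : #|F| ^ 3 < n ^ 4.
Let N := 2 * (k * w).
Local Open Scope ring_scope.

Lemma heffter_space_of_field : heffter_space_exists (#|F|.-1)./2 k r.
Proof.
have [g prim [log logK logg]] := field_generator F.
have N0 : (0 < N)%N.
  by have := prim_order_gt0 prim; rewrite cardF -mulnA muln_gt0 => /andP[].
have g0 m : g ^+ m != 0.
  by rewrite expf_neq0 // (prim_root_eq0 prim) -lt0n (prim_order_gt0 prim).
have [f fM f0] := fin_all_exists2 (fun a : 'I_r =>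
  log_zero_sum prim cardF large (fun i => i + N * (a * i))%N k3).
have fN a i : f a i = i %[mod N].
  by rewrite (eq_mod_dvdn (dvdn_mulr L (dvdnn N)) (fM a i)) addnC mulnC modnMDl.
pose c y := (log y %% N)%N.
have cltN y : (c y < N)%N by rewrite ltn_mod.
have cM (y : F) m : y != 0 -> c (y * g ^+ m) = ((c y + m) %% N)%N.
  move=> y0; rewrite /c -{1}(logK y y0) -exprD modnDml.
  by apply: eq_mod_dvdn (logg _); rewrite cardF -mulnA dvdn_mulr.
(* Here [-1 = g ^ (k * w * (L * n))], and [L * n] is odd, so this exponent is [k * w] modulo [N]. *)
have cN (y : F) : y != 0 -> c (- y) = ((c y + k * w) %% N)%N.
  move=> y0; have -> : - y = y * g ^+ (k * w * (L * n)).
    rewrite -mulrN1; congr (_ * _); apply/esym/eqP.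
    have : (g ^+ (k * w * (L * n))) ^+ 2 == 1.
      rewrite -exprM -(prim_order_dvd prim) cardF.
      by have -> : (k * w * (L * n) * 2 = 2 * (k * w) * L * n)%N by lia.
    rewrite sqrf_eq1 => /orP[|//].
    rewrite -(prim_order_dvd prim) => /dvdn_leq.
    have := prim_order_gt0 prim; rewrite cardF; lia.
  rewrite cM // -modnDmr; congr ((_ + _) %% _)%N.
  rewrite -(odd_double_half (L * n)) odd_Ln.
  have -> : (k * w * (1 + (L * n)./2.*2) = (L * n)./2 * N + k * w)%N.
    by rewrite /N; nia.
  by rewrite modnMDl modn_small // /N; lia.
pose V := [set y | (y != 0) && (c y < k * w)%N].
have kwN : (k * w + k * w = N)%N by rewrite /N; lia.
have halfV : is_half_set V.
  split.
    rewrite -setI_eq0; apply/eqP/setP => y; rewrite !inE; apply/negP.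
    case/andP=> /andP[y0 cy] /imsetP[x]; rewrite inE => /andP[x0 cx] e.
    by move: cy; rewrite e cN // modn_small; lia.
  apply/setP => y; rewrite !inE.
  have [->|y0] := eqVneq y 0.
    apply/negP => /imsetP[x]; rewrite inE => /andP[x0 _] /eqP.
    by rewrite eq_sym oppr_eq0 (negPf x0).
  case: ltnP => //= cy; apply/imsetP; exists (- y); last by rewrite opprK.
  rewrite inE oppr_eq0 y0 cN //=.
  have -> : (c y + k * w = N + (c y - k * w))%N by lia.
  by rewrite modnDl modn_small; have := cltN y; lia.
have cardV : #|V| = (#|F|.-1)./2.
  have [disj cov] := halfV.
  rewrite -(cardsC1 (0 : F)) -cov cardsU (disjoint_setI0 disj) cards0 subn0.
  by rewrite card_imset ?addnn ?doubleK //; exact: oppr_inj.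
(* The scalar [s] of the block through [y]: as [k] divides [c s], the index of [y] in the tuple is
   [c y] modulo [k]. Blocks are the fibres of [rho a] on [V]. *)
pose rho a y := y / g ^+ f a (c y %% k)%N.
(* No reduction modulo [N] occurs, since [k * c1 + i < k * w]. *)
have blockc a s c1 i : s != 0 -> c s = (k * c1)%N -> (c1 < w)%N -> (i < k)%N ->
    c (s * g ^+ f a i) = (k * c1 + i)%N.
  move=> s0 cs c1w ik; rewrite cM // -modnDmr fN modnDmr cs modn_small //.
  by nia.
have blockP a A : A \in preim_partition (rho a) V ->
    exists s c1, [/\ s != 0, c s = (k * c1)%N, (c1 < w)%N &
      A = [set s * g ^+ f a j | j : 'I_k]].
  case/imsetP=> x; rewrite inE => /andP[x0 cx] ->.
  have k0 : (0 < k)%N by lia.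
  have ik : (c x %% k < k)%N by rewrite ltn_mod.
  have c1w : (c x %/ k < w)%N by rewrite ltn_divLR // mulnC.
  have s0 : rho a x != 0 by rewrite mulf_neq0 ?invr_neq0.
  have cs : c (rho a x) = (k * (c x %/ k))%N.
    have : (c (rho a x) + c x %% k == k * (c x %/ k) + c x %% k %[mod N])%N.
      have := cM (rho a x) (f a (c x %% k)%N) s0; rewrite divfK // => e.
      rewrite [(k * _)%N]mulnC -divn_eq (modn_small (cltN x)).
      set i := (c x %% k)%N in e *; rewrite e.
      by rewrite -(modnDmr _ (f _ _)) fN modnDmr.
    rewrite eqn_modDr !modn_small // => [/eqP //|].
    by have := cltN x; rewrite {1}(divn_eq (c x) k); lia.
  exists (rho a x), (c x %/ k)%N; split=> //.
  apply/setP => y; rewrite !inE; apply/andP/imsetP.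
    case=> /andP[y0 cy] /eqP e.
    by exists (Ordinal (ltn_pmod (c y) k0)); rewrite //= e divfK.
  case=> j _ ->; have cy := blockc a _ _ _ s0 cs c1w (ltn_ord j).
  rewrite mulf_neq0 // /rho cy; split; first by have := ltn_ord j; nia.
  rewrite [in X in _ == X]mulnC modnMDl (modn_small (ltn_ord j)).
  by rewrite mulfK.
rewrite -cardV.
apply: (@heffter_space_of_partitions F k r V
  (fun a => preim_partition (rho a) V)).
- by lia.
- rewrite -card_gt0 cardV.
  have := prim_order_gt0 prim; rewrite cardF; lia.
- exact: halfV.
- by move=> a; exact: preim_partitionP.
- move=> a A /blockP[s [c1 [s0 cs c1w ->]]].
  have inj : injective (fun j : 'I_k => s * g ^+ f a j).
    by move=> i j /(congr1 c); rewrite !(blockc a s c1) // => /addnI/val_inj.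
  rewrite card_imset // card_ord big_imset /=; last exact: in2W.
  by rewrite -big_distrr /= f0 mulr0.
move=> a b A A' ab /blockP[s [c1 [s0 cs c1w ->]]].
move=> /blockP[s' [c1' [s0' cs' c1w' ->]]].
apply/card_le1_eqP => y y'; rewrite !inE.
(* A common point has the same index in both blocks, its logarithm modulo [k]. *)
have idx (z : F) : z \in [set s * g ^+ f a j | j : 'I_k] ->
    z \in [set s' * g ^+ f b j | j : 'I_k] ->
    exists2 i : 'I_k, z = s * g ^+ f a i & z = s' * g ^+ f b i.
  move=> /imsetP[i _ e] /imsetP[i' _ e']; exists i => //.
  rewrite e'; congr (_ * _ ^+ f b _).
  have : (k * c1 + i)%N = (k * c1' + i')%N 
    by rewrite -(blockc a s) // -(blockc b s') // -e -e'.
  move=> /(congr1 (modn^~ k)).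
  by rewrite ![(k * _)%N]mulnC !modnMDl !modn_small.
move=> /andP[/idx h1 /h1 {h1}[i e1 e2]] /andP[/idx h2 /h2 {h2}[j e3 e4]].
(* Cross-multiplying the expressions of the two common points cancels [s] and [s']. *)
have : f a i + f b j = f b i + f a j %[mod N * L].
  apply: (@eq_mod_dvdn _ #|F|.-1); first by rewrite cardF dvdn_mulr.
  apply/eqP; rewrite -(eq_prim_root_expr prim) !exprD.
  apply/eqP/(mulfI s0)/(mulfI s0').
  transitivity ((s * g ^+ f a i) * (s' * g ^+ f b j)).
    by rewrite [RHS]mulrACA [LHS]mulrCA mulrA.
  by rewrite -e1 -e4 e2 e3 [LHS]mulrACA -mulrA.
rewrite -modnDm !fM modnDm -[in X in _ = X]modnDm !fM modnDm.
have -> : (i + N * (a * i) + (j + N * (b * j))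
           = i + j + N * (a * i + b * j))%N by lia.
have -> : (i + N * (b * i) + (j + N * (a * j))
           = i + j + N * (b * i + a * j))%N by lia.
(* Both [a * i + b * j] and [b * i + a * j] are below [2 * (r * k) < L], so the congruence modulo
   [L] is an equality. *)
move/eqP; rewrite eqn_modDl -!muln_modr eqn_pmul2l // !modn_small; first last.
- have := (ltn_ord a, ltn_ord b, ltn_ord i, ltn_ord j) => -[[[]]]; nia.
- have := (ltn_ord a, ltn_ord b, ltn_ord i, ltn_ord j) => -[[[]]]; nia.
move/eqP/cross_products_eq => [/val_inj e|/val_inj e].
  by rewrite e eqxx in ab.
by rewrite e1 e3 e.
Qed.

End HeffterSpaceOfField.

(** * Choice of the field, with arbitrarily large order *)

Lemma geometric_sum_mod (Q D e : nat) :
  Q = 1 %[mod D] -> \sum_(i < e) Q ^ i = e %[mod D].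
Proof.
move=> Q1; elim: e => [|e IH]; first by rewrite big_ord0.
by rewrite big_ord_recr /= -modnDm IH -modnXm Q1 modnXm exp1n modnDm addn1.
Qed.

(** A prime above [D] is coprime to [D], so Euler's theorem applies. *)
Lemma prime_power_1mod (D m : nat) : 1 < D ->
  exists p e, [/\ prime p, 0 < e, m < p ^ e & p ^ e = 1 %[mod D]].
Proof.
move=> D1; have [p pm pp] := prime_above (m + D).
exists p, (totient D).
have e0 : 0 < totient D by rewrite totient_gt0; lia.
split=> //.
  apply: (@leq_trans p); first by lia.
  by rewrite -{1}[p]expn1 leq_pexp2l // prime_gt0.
apply: Euler_exp_totient; rewrite prime_coprime // gtnNdvd; lia.
Qed.

(* With [Q = 1 %[mod 2 * k * L]] and [q = Q ^ L], the cofactor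
   [(q - 1) / (Q - 1)] is congruent to [L] modulo [2 * k * L], hence an odd
   multiple of [L], while [L >= 9] makes the classes modulo [(Q - 1) * L] larger
   than [q ^ (3 / 4)]. *)
Lemma heffter_space_unbounded (k r m : nat) :
  3 <= k -> exists2 v, m < v & heffter_space_exists v k r.
Proof.
(* The summand [9] makes [L] odd and ensures [3 * L <= 4 * (L - 2)]. *)
move=> k3; pose L := (2 * (r * k) + 9)%N; pose D := (2 * k * L)%N.
have D1 : 1 < D by rewrite /D /L; nia.
(* The bound [2 * m + 2] gives [m < (q - 1) / 2]. *)
have [p [e [pp e0 mQ Q1]]] := @prime_power_1mod D (2 * m + 2) D1.
set Q := p ^ e in mQ Q1.
have [w [Qw LQ]] : exists w, Q.-1 = 2 * (k * w) /\ L < Q.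
  have /dvdnP[u Qu] : D %| Q.-1.
    by rewrite -subn1 -(eqn_mod_dvd _ (_ : 1 <= Q)) ?Q1 //; lia.
  have u0 : 0 < u by case: u Qu => [|//]; lia.
  exists (L * u); rewrite Qu /D; split; first by lia.
  have : L <= u * (2 * k) * L by rewrite leq_pmull // muln_gt0 u0; lia.
  by rewrite -mulnA -Qu; lia.
pose T := \sum_(i < L) Q ^ i.
have TL : T = L %[mod D] := geometric_sum_mod L Q1.
have /dvdnP[n Tn] : L %| T.
  by rewrite /dvdn (eq_mod_dvdn _ TL) ?modnn // dvdn_mull.
have oddT : odd T.
  have : T = L %[mod 2] by apply: eq_mod_dvdn TL; rewrite /D -mulnA dvdn_mulr.
  by rewrite !modn2 /L oddD oddM; case: (odd T).
have L0 : 0 < L by rewrite /L; lia.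
have [|F _ cardF] := @pPrimePowerField p (e * L) pp.
  by rewrite muln_gt0 e0.
have Q0 : 0 < Q by lia.
exists (#|F|.-1)./2.
  have : Q <= #|F| by rewrite cardF expnM -/Q -{1}[Q]expn1 leq_pexp2l.
  by lia.
apply: (@heffter_space_of_field F k w L n) => //.
- by rewrite cardF expnM predn_exp -/Q -/T Tn Qw; lia.
- by rewrite mulnC -Tn.
- by rewrite /L; lia.
(* [L * n = T] is at least its top term [Q ^ (L - 1)], and [L < Q]. *)
have nQ : Q ^ (L - 2) < n.
  rewrite -(@ltn_pmul2r L) // -Tn.
  apply: (@leq_trans (Q ^ L.-1)).
    have -> : L.-1 = (L - 2).+1 by rewrite /L; lia.
    by rewrite expnSr ltn_pmul2l // expn_gt0 Q0.
  by rewrite /T -(prednK L0) big_ord_recr leq_addl.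
rewrite cardF expnM -/Q -expnM.
apply: leq_ltn_trans (_ : _ <= (Q ^ (L - 2)) ^ 4) _; last by rewrite ltn_exp2r.
by rewrite -expnM leq_pexp2l //; lia.
Qed.

Theorem theorem1p2 (k r : nat) (hk : 3 <= k) :
  infinite_set [set v : nat | heffter_space_exists v k r]%classic.
Proof.
move=> /finite_seqP[s sE].
have [v vs vE] := heffter_space_unbounded r (\max_(i <- s) i) hk.
have vins : v \in s.
  suff: [set` s]%classic v by [].
  by rewrite -sE.
by move: vs; rewrite ltnNge (leq_bigmax_seq v vins).
Qed.
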